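(* There exist a Lipschitz function $f:\mathbb{R}^{2}\to\mathbb{R}$ and a set $M\subset\mathbb{R}^{2}$ such that \begin{itemize} \item $f$ is locally convex on $\mathbb{R}^{2}\setminus M$, \item $f$ is not convex on $\mathbb{R}^{2}$, \item $M$ is compact and totally disconnected, \item $f$ has compact support. \end{itemize}
   Context: For $x,y\in\mathbb{R}^2$, $[x,y]$ denotes the closed line segment with endpoints $x$ and $y$. A function $f$ is called locally convex on a set $A\subset\mathbb{R}^2$ if for every $x,y$ such that $[x,y]\subset A$ and every $\alpha\in[0,1]$ we have $f(\alpha x+(1-\alpha)y)\leq \alpha f(x)+(1-\alpha) f(y)$. *)

(* Defs.v *)
From HB Require Import structures.
From mathcomp Require Import all_boot all_order all_algebra.
From mathcomp Require Import all_classical all_reals all_analysis.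

Set Implicit Arguments.
Unset Strict Implicit.
Unset Printing Implicit Defensive.

Import Order.TTheory GRing.Theory Num.Theory.
Import numFieldNormedType.Exports.

Local Open Scope classical_set_scope.
Local Open Scope ring_scope.

(* R^2 is rendered as 'rV[R]_2, whose library norm is the sup norm; Lipschitz
   continuity does not depend on this choice, as all norms on R^2 are equivalent. *)

Definition segment (R : realType) (E : lmodType R) (x y : E) : set E :=
  [set t *: x + (1 - t) *: y | t in `[0, 1]%classic].

Definition locally_convex_on (R : realType) (E : lmodType R)
    (A : set E) (f : E -> R) : Prop :=
  forall x y : E, segment x y `<=` A ->
  forall t : R, 0 <= t <= 1 ->
    f (t *: x + (1 - t) *: y) <= t * f x + (1 - t) * f y.

Definition compactly_supported (R : realType) (T : topologicalType)
    (f : T -> R) : Prop :=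
  compact (closure [set x | f x != 0]).

(* Main.v *)
Require Import Defs.
From HB Require Import structures.
From mathcomp Require Import all_boot all_order all_algebra.
From mathcomp Require Import all_classical all_reals all_analysis.
From mathcomp Require Import ring lra.
Import Order.TTheory GRing.Theory Num.Theory.
Import numFieldNormedType.Exports.
Local Open Scope classical_set_scope.
Local Open Scope ring_scope.

(** Call a point of the plane singular for [f] when [f] is convex on no ball
around it.  Apart from finitely many points, the singular set of a compactly
supported piecewise affine function consists of folds, i.e. of points near which
the function is the minimum of two affine functions.  Such a set can be cut at
any fold by a change of the function that is as local as desired and hardly
affects its gradients.

The cut is the heart of the proof ([notch]).  In coordinates [u] across the
fold and [v] along it, and up to an affine summand, the function is [- |u|],
singular on the line [u = 0].  Replace it by its maximum with the pyramid
[q = min (al + v) (mu * (al - v) - (1 + 2 * mu) * |u|)].  A maximum of convex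
functions is convex, so the new singular points are the old ones where
[q <= - |u|], together with the singular points of [q] where [q >= - |u|].
The latter form a figure shaped like an upside-down Y: a tail on the line,
ending where the line resumes at [v = al], and two legs that reach the
boundary of the pyramid at [(+- 2 * al, - 3 * al)].  The legs straddle the
lower part of the line, which stops at [v = - al], strictly below the place
where the legs join.  Hence the singular set is now disconnected there: one
passes through the tent-shaped corridor between the legs and the lower part of
the line.  Taking the gradient of [v] and the number [mu] small
keeps all gradients as close as desired to the convex hull of the two old
ones, so that one and the same Lipschitz bound survives all the steps.

Given a coordinate strip [s < z_i < t], almost every line [z_i = xi] inside it
meets the singular set at finitely many folds; notching all of them splits the
singular set into two disjoint closed parts, one in [z_i < t] and the other in
[s < z_i] ([cut_strip]).  Doing this successively for all coordinates and all
rational [s < t], and shrinking at each step an open neighbourhood [U_n] of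
the singular set outside of which nothing changes any more, yields an
increasing sequence of uniformly Lipschitz functions.  The limit [f] coincides
with the [n]-th function off [U_n], hence is convex near every point outside
[M = \bigcap_n U_n], and therefore along every segment that avoids [M]
([convex_at_segment]).  All the cuts together make [M] totally disconnected
([separates_totally_disconnected]).  The process starts from the positive part
of a pyramid, so that [f] has compact support and takes a positive value, which
rules out convexity ([bump_not_convex]). *)

Set Implicit Arguments.
Unset Strict Implicit.
Unset Printing Implicit Defensive.

(** * Points of local convexity *)

Section LocalConvexity.
Context {R : realType} {V : normedModType R}.
Implicit Types (f g : V -> R) (p x y : V).

Definition convex_at f p :=
  exists2 r : R, 0 < r & forall x y, ball p r x -> ball p r y ->
    forall t : R, 0 <= t <= 1 ->
      f (t *: x + (1 - t) *: y) <= t * f x + (1 - t) * f y.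

Definition nonconvex_pts f : set V := [set p | ~ convex_at f p].

Lemma ball_conv p r x y (t : R) : ball p r x -> ball p r y -> 0 <= t <= 1 ->
  ball p r (t *: x + (1 - t) *: y).
Proof.
rewrite -!ball_normE /= => px py /andP[t0 t1].
have -> : p - (t *: x + (1 - t) *: y) = t *: (p - x) + (1 - t) *: (p - y).
  by rewrite !scalerBr [in RHS]addrACA -scalerDl subrKC scale1r opprD.
apply: le_lt_trans (ler_normD _ _) _; rewrite !normrZ ger0_norm// ger0_norm ?subr_ge0//.
have : t * `|p - x| <= t * Num.max `|p - x| `|p - y|.
  by rewrite ler_wpM2l// le_max lexx.
have : (1 - t) * `|p - y| <= (1 - t) * Num.max `|p - x| `|p - y|.
  by rewrite ler_wpM2l ?subr_ge0// le_max lexx orbT.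
have : Num.max `|p - x| `|p - y| < r by rewrite gt_max px.
set m := Num.max _ _; lra.
Qed.

Lemma convex_at_near f g p : (\forall z \near p, f z = g z) ->
  convex_at g p -> convex_at f p.
Proof.
move=> /nbhs_ballP[/= r1 r10 fg] [r2 r20 cg].
exists (Num.min r1 r2); first by rewrite lt_min r10.
move=> x y px py t t01.
have h z : ball p (Num.min r1 r2) z -> ball p r1 z /\ ball p r2 z.
  by move=> pz; split; apply: le_ball pz; rewrite ge_min lexx// orbT.
rewrite !fg; [apply: cg => //|..]; try by case: (h _ px); case: (h _ py).
by case: (h _ (ball_conv px py t01)).
Qed.

Lemma convex_at_max f g p : convex_at f p -> convex_at g p ->
  convex_at (fun z => Num.max (f z) (g z)) p.
Proof.
move=> [r1 r10 cf] [r2 r20 cg].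
exists (Num.min r1 r2); first by rewrite lt_min r10.
move=> x y px py t /[dup] t01 /andP[t0 t1].
have h z : ball p (Num.min r1 r2) z -> ball p r1 z /\ ball p r2 z.
  by move=> pz; split; apply: le_ball pz; rewrite ge_min lexx// orbT.
have [px1 px2] := h _ px; have [py1 py2] := h _ py.
rewrite ge_max; apply/andP; split.
  apply: (le_trans (cf _ _ px1 py1 _ t01)).
  by apply: lerD; apply: ler_wpM2l; rewrite ?subr_ge0// le_max lexx.
apply: (le_trans (cg _ _ px2 py2 _ t01)).
by apply: lerD; apply: ler_wpM2l; rewrite ?subr_ge0// le_max lexx orbT.
Qed.

Lemma nonconvex_closed f : closed (nonconvex_pts f).
Proof.
rewrite -[nonconvex_pts f]setCK; apply: open_closedC; rewrite openE => p.
rewrite /nonconvex_pts /= notK => -[r r0 cf].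
apply/nbhs_ballP; exists (r / 2) => /=; first by rewrite divr_gt0.
move=> q pq /=; rewrite notK; exists (r / 2); first by rewrite divr_gt0.
move=> x y qx qy t t01.
by apply: cf => //; rewrite [r]splitr; apply: ball_triangle pq _.
Qed.

(** The difference [phi] between [f] and its chord vanishes at both ends.  If
it were positive somewhere, so would be the maximum of [phi + e * (t^2 - t)] for
a suitable [e > 0]; at an interior maximum this contradicts the strict convexity
that local convexity of [phi] gives to the perturbed function. *)
Lemma convex_at_segment f x y : continuous f ->
  (forall z, segment x y z -> convex_at f z) ->
  forall t : R, 0 <= t <= 1 ->
    f (t *: x + (1 - t) *: y) <= t * f x + (1 - t) * f y.
Proof.
move=> cf cvx t0 /andP[t00 t01].
pose s (t : R) : V := t *: x + (1 - t) *: y.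
rewrite leNgt; apply/negP => gap.
pose phi (t : R) := f (s t) - (t * f x + (1 - t) * f y).
have phi0 : 0 < phi t0 by rewrite subr_gt0.
(* [t^2 - t >= - 1 / 4], so this [e] keeps the perturbed gap positive at [t0]. *)
pose e := phi t0.
pose psi (t : R) := phi t + e * (t ^+ 2 - t).
have cs : continuous s.
  move=> u; apply: cvgD; first by apply: cvgZr_tmp; apply: cvg_id.
  by apply: cvgZr_tmp; apply: cvgB; [exact: cvg_cst|exact: cvg_id].
have cpsi : continuous psi.
  move=> u; apply: cvgD.
    apply: cvgB; first exact: (continuous_comp (cs u) (cf _)).
    apply: cvgD; apply: cvgM; try exact: cvg_cst; first exact: cvg_id.
    by apply: cvgB; [exact: cvg_cst|exact: cvg_id].
  apply: cvgM; first exact: cvg_cst.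
  by apply: cvgB; [exact: exprn_continuous|exact: cvg_id].
have [c] := @EVT_max R psi 0 1 ler01 (continuous_subspaceT cpsi).
rewrite in_itv/= => /andP[c0 c1] maxc.
have psit0 : 0 < psi t0.
  have -> : psi t0 = phi t0 * (1 + t0 ^+ 2 - t0) by rewrite /psi /e; ring.
  by rewrite mulr_gt0//; nra.
have psic : 0 < psi c.
  by apply: (lt_le_trans psit0); apply: maxc; rewrite in_itv/= t00.
have psi00 : psi 0 = 0.
  by rewrite /psi /phi /s scale0r add0r subr0 scale1r; ring.
have psi11 : psi 1 = 0.
  by rewrite /psi /phi /s scale1r subrr scale0r addr0; ring.
have c0' : 0 < c.
  by rewrite lt_neqAle c0 andbT; apply/eqP => c0E; move: psic; rewrite -c0E psi00 ltxx.
have c1' : c < 1.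
  by rewrite lt_neqAle c1 andbT; apply/eqP => c0E; move: psic; rewrite c0E psi11 ltxx.
have [r r0 loc] : convex_at f (s c).
  by apply: cvx; exists c => //=; rewrite in_itv/= c0.
have /nbhs_ballP[/= d d0 sd] : \forall t \near c, ball (s c) r (s t).
  by apply: cs; exact: nbhsx_ballx.
pose h := Num.min (d / 2) (Num.min c (1 - c)).
have h0 : 0 < h by rewrite !lt_min divr_gt0// c0' subr_gt0.
have hd : h < d.
  by rewrite (@le_lt_trans _ _ (d / 2)) ?ge_min ?lexx//; move: d0; lra.
have hc : h <= c by rewrite !ge_min lexx orbT.
have hc1 : h <= 1 - c by rewrite !ge_min lexx !orbT.
have bm : ball (s c) r (s (c - h)).
  by apply: sd; rewrite -ball_normE /= opprB addrC subrK gtr0_norm.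
have bp : ball (s c) r (s (c + h)).
  by apply: sd; rewrite -ball_normE /= opprD addrA subrr sub0r normrN gtr0_norm.
have := loc _ _ bm bp (1 / 2).
have -> : (1 / 2) *: s (c - h) + (1 - 1 / 2) *: s (c + h) = s c.
  rewrite /s !scalerDr !scalerA addrACA -!scalerDl.
  by congr (_ *: _ + _ *: _); field.
move=> /(_ ltac:(lra)) mid.
have m1 : psi (c - h) <= psi c by apply: maxc; rewrite in_itv/=; lra.
have m2 : psi (c + h) <= psi c by apply: maxc; rewrite in_itv/=; lra.
have e0 : 0 < e by [].
have : 0 < e * (h * h) by rewrite !mulr_gt0.
move: mid m1 m2; rewrite /psi /phi; nra.
Qed.

End LocalConvexity.

(** * Raising a function inside a ball *)

Section Raise.
Context {R : realType} {V : normedModType R}.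
Implicit Types (f g Q : V -> R) (p x y z : V) (L : R).

Definition Lip L f := forall x y, `|f x - f y| <= L * `|x - y|.

Lemma Lip_continuous L f : Lip L f -> continuous f.
Proof.
move=> fL x; apply/cvgrPdist_lt => e e0.
have L0 : 0 < `|L| + 1 by rewrite ltr_wpDl.
apply/nbhs_ballP; exists (e / (`|L| + 1)) => /=; first by rewrite divr_gt0.
move=> y; rewrite -ball_normE /= ltr_pdivlMr// => xy.
apply: le_lt_trans (fL _ _) _; apply: le_lt_trans xy; rewrite mulrC.
by rewrite ler_wpM2l// (le_trans (ler_norm _))// lerDl.
Qed.

Lemma lt_near f g z : continuous f -> continuous g -> f z < g z ->
  \forall x \near z, f x < g x.
Proof.
move=> cf cg fg.
have cd : continuous (fun x => g x - f x).
  by move=> x; apply: cvgB; [exact: cg|exact: cf].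
have := cd z; move=> /(_ [set r | 0 < r]) H.
have : \forall x \near z, 0 < g x - f x.
  by apply: H; apply: open_nbhs_nbhs; split; [exact: open_gt|rewrite /= subr_gt0].
by apply: filterS => x; rewrite subr_gt0.
Qed.

Lemma dist_continuous p : continuous (fun z => `|z - p|).
Proof.
apply: (@Lip_continuous 1) => x y; rewrite mul1r.
by apply: le_trans (ler_dist_dist _ _) _; rewrite opprB addrA subrK.
Qed.

Lemma near_dist_lt p (r : R) z : `|z - p| < r -> \forall x \near z, `|x - p| < r.
Proof.
apply: (@lt_near (fun x => `|x - p|) (fun=> r)); first exact: dist_continuous.
by move=> x; apply: cvg_cst.
Qed.

Lemma max_dist (a b c d e : R) : `|a - c| <= e -> `|b - d| <= e ->
  `|Num.max a b - Num.max c d| <= e.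
Proof. by rewrite !ler_norml; case: (leP a b); case: (leP c d) => *; lra. Qed.

Lemma min_dist (a b c d e : R) : `|a - c| <= e -> `|b - d| <= e ->
  `|Num.min a b - Num.min c d| <= e.
Proof. by rewrite !ler_norml; case: (leP a b); case: (leP c d) => *; lra. Qed.

Lemma Lip_min L f g : Lip L f -> Lip L g -> Lip L (fun z => Num.min (f z) (g z)).
Proof. by move=> fL gL x y; apply: min_dist. Qed.

(** [Q] is only used near [p], because a minimum of affine functions need not
stay below [f] far away.  The results below assume [Q < f] on the annulus
between the radii [r / 4] and [r], so that nothing happens at the border of the
ball. *)
Definition raise f Q p (r : R) z :=
  if `|z - p| < r then Num.max (f z) (Q z) else f z.

Context (f Q : V -> R) (p : V) (r L : R).
Hypotheses (r0 : 0 < r) (fL : Lip L f) (QL : Lip L Q).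
Hypothesis Qlow : forall z, r / 4 <= `|z - p| -> `|z - p| < r -> Q z < f z.

Lemma raise_ge z : f z <= raise f Q p r z.
Proof. by rewrite /raise; case: ifP => // _; rewrite le_max lexx. Qed.

Lemma raise_out z : r / 4 <= `|z - p| -> raise f Q p r z = f z.
Proof.
by move=> zp; rewrite /raise; case: ifP => // zr; rewrite max_l// ltW// Qlow.
Qed.

(** For [x] in the small ball and [y] outside the large one, the segment from
[x] to [y] contains a point [z] of the annulus, where the new function is both
[f] and the maximum of [f] and [Q]; the estimates on the two halves add up. *)
Lemma raise_Lip : Lip L (raise f Q p r).
Proof.
have fQL x y : `|Num.max (f x) (Q x) - Num.max (f y) (Q y)| <= L * `|x - y|.
  exact: max_dist.
have key x y : `|x - p| < r / 4 -> `|raise f Q p r x - raise f Q p r y| <= L * `|x - y|.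
  move=> xp; have [yp|yp] := ltP `|y - p| r.
    by rewrite /raise yp (lt_trans xp)//; move: r0; lra.
  have xy : 3 / 4 * r < `|y - x|.
    have : `|y - p| <= `|y - x| + `|x - p|.
      by rewrite (le_trans _ (ler_normD _ _))// subrKA.
    by move: r0; lra.
  (* [z] lies at distance [r / 2] from [x], hence between [r / 4] and
     [3 * r / 4] from [p]. *)
  pose t := r / 2 / `|y - x|; pose z := x + t *: (y - x).
  have yx0 : 0 < `|y - x| by move: r0; lra.
  have t0 : 0 < t by rewrite !divr_gt0.
  have t1 : t < 1 by rewrite ltr_pdivrMr// mul1r; move: r0; lra.
  have zx : z - x = t *: (y - x) by rewrite /z addrAC subrr add0r.
  have xz : `|z - x| = r / 2.
    by rewrite zx normrZ gtr0_norm// /t divfK// gt_eqF.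
  have yz : `|y - x| = `|z - x| + `|y - z|.
    have -> : y - z = (1 - t) *: (y - x).
      by rewrite /z scalerBl scale1r opprD addrA.
    rewrite zx 2!(@normrZ _ V) (gtr0_norm t0) (gtr0_norm (_ : 0 < 1 - t)) ?subr_gt0//.
    by ring.
  have zp1 : r / 4 <= `|z - p|.
    have : `|z - x| <= `|z - p| + `|x - p|.
      by rewrite -(distrC p x) (le_trans _ (ler_normD _ _))// subrKA.
    by rewrite xz; move: xp; lra.
  have zp2 : `|z - p| < r.
    have : `|z - p| <= `|z - x| + `|x - p|.
      by rewrite (le_trans _ (ler_normD _ _))// subrKA.
    by rewrite xz; move: xp r0; lra.
  rewrite (raise_out (z := y)); last by move: yp r0; lra.
  have := fQL x z; rewrite (max_l (ltW (Qlow zp1 zp2))).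
  rewrite /raise ifT; last by move: xp r0; lra.
  have := fL z y; rewrite -(distrC y x) yz -(distrC y z) -(distrC z x) mulrDr.
  move=> h1 h2; rewrite -[X in `|X|](subrKA (f z)) (le_trans (ler_normD _ _))//.
  by rewrite lerD.
move=> x y; have [xp|xp] := ltP `|x - p| (r / 4); first exact: key.
have [yp|yp] := ltP `|y - p| (r / 4).
  by rewrite distrC (distrC x); exact: key.
by rewrite !raise_out//.
Qed.

Let cf := Lip_continuous fL.
Let cQ := Lip_continuous QL.
Lemma raise_near_in z : `|z - p| < r ->
  \forall x \near z, raise f Q p r x = Num.max (f x) (Q x).
Proof.
move=> /near_dist_lt; apply: filterS => x xp.
by rewrite /raise xp.
Qed.

Lemma raise_near_out z : r / 4 < `|z - p| ->
  \forall x \near z, raise f Q p r x = f x.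
Proof.
move=> zr; have := @lt_near (fun=> r / 4) (fun x => `|x - p|) z.
move=> /(_ (fun x => @cvg_cst _ _ _ _ _) (@dist_continuous p) zr).
apply: filterS => x xp.
by rewrite raise_out// ltW.
Qed.

Lemma raise_near_Q z : `|z - p| < r -> f z < Q z ->
  \forall x \near z, raise f Q p r x = Q x.
Proof.
move=> zp /(lt_near cf cQ); move: (raise_near_in zp).
by apply: filterS2 => x -> fQ; rewrite max_r// ltW.
Qed.

Lemma raise_near_f z : `|z - p| < r -> Q z < f z ->
  \forall x \near z, raise f Q p r x = f x.
Proof.
move=> zp /(lt_near cQ cf); move: (raise_near_in zp).
by apply: filterS2 => x -> fQ; rewrite max_l// ltW.
Qed.

Lemma nonconvex_near g h z : (\forall x \near z, g x = h x) ->
  nonconvex_pts g z -> nonconvex_pts h z.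
Proof. by move=> gh sg ch; apply: sg; apply: convex_at_near ch. Qed.

(** Where [f] and [Q] are equal, the maximum is convex as soon as both of them
are; elsewhere only the larger one matters. *)
Lemma nonconvex_raise z : nonconvex_pts (raise f Q p r) z ->
  (nonconvex_pts f z /\ (`|z - p| < r -> Q z <= f z)) \/
  [/\ nonconvex_pts Q z, `|z - p| < r / 4 & f z <= Q z].
Proof.
move=> Sz; have [zp|zp] := ltP `|z - p| (r / 4); last first.
  have [zr|zr] := ltP `|z - p| r.
    left; split; last by move=> _; rewrite ltW// Qlow.
    by apply: nonconvex_near Sz; apply: raise_near_f => //; apply: Qlow.
  left; split; last by [].
  by apply: nonconvex_near Sz; apply: raise_near_out; move: zr r0; lra.
have zr : `|z - p| < r by move: zp r0; lra.
have [fQ|Qf|fQ] := ltgtP (f z) (Q z).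
- by right; split=> //; apply: nonconvex_near Sz; apply: raise_near_Q.
- by left; split=> //; apply: nonconvex_near Sz; apply: raise_near_f.
- have [sf|sf] := pselect (nonconvex_pts f z); first by left; split.
  have [sq|sq] := pselect (nonconvex_pts Q z); first by right; split.
  exfalso; apply: Sz; apply: (convex_at_near (raise_near_in zr)).
  by apply: convex_at_max; [move/contrapT: sf|move/contrapT: sq].
Qed.

End Raise.

(** * Minima of affine functions in the plane *)

Section Plane.
Context {R : realType}.
Local Notation pt := 'rV[R]_2.
Implicit Types (f Q a : pt -> R) (p z w g : pt) (L : R).

Lemma I2P (P : 'I_2 -> Prop) : P 0 -> P 1 -> forall i, P i.
Proof.
move=> P0 P1 [[|[|//]] h].
- by rewrite (_ : Ordinal h = 0)//; apply: val_inj.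
- by rewrite (_ : Ordinal h = 1)//; apply: val_inj.
Qed.

Lemma rV2P z w : z 0 0 = w 0 0 -> z 0 1 = w 0 1 -> z = w.
Proof. by move=> h0 h1; apply/rowP; apply: I2P. Qed.

Lemma coord_le_norm z i : `|z 0 i| <= `|z|.
Proof.
rewrite [leRHS]/Num.norm /= mx_normrE; apply/bigmax_geP; right => /=.
by exists (0, i).
Qed.

Lemma norm_lt_coord z (c : R) : `|z 0 0| < c -> `|z 0 1| < c -> `|z| < c.
Proof.
move=> h0 h1; rewrite [ltLHS]/Num.norm /= mx_normrE; apply/bigmax_ltP; split.
  exact: le_lt_trans h0.
by move=> [i j] _ /=; rewrite (ord1 i); move: j; apply: I2P.
Qed.

Definition dot g z : R := g 0 0 * z 0 0 + g 0 1 * z 0 1.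

(** The norm of the gradient [g] dual to the supremum norm of the plane. *)
Definition l1 g : R := `|g 0 0| + `|g 0 1|.

Lemma dotD g z w : dot g (z + w) = dot g z + dot g w.
Proof. by rewrite /dot !mxE; ring. Qed.

Lemma dotZ g z (t : R) : dot g (t *: z) = t * dot g z.
Proof. by rewrite /dot !mxE; ring. Qed.

Lemma dot_le g z : `|dot g z| <= l1 g * `|z|.
Proof.
rewrite (le_trans (ler_normD _ _))// !normrM mulrDl.
by rewrite lerD// ler_wpM2l// coord_le_norm.
Qed.

Lemma l1_ge0 g : 0 <= l1 g. Proof. by rewrite addr_ge0. Qed.

Lemma l1D g h : l1 (g + h) <= l1 g + l1 h.
Proof. by rewrite /l1 !mxE addrACA lerD// ler_normD. Qed.

Lemma l1Z (t : R) g : l1 (t *: g) = `|t| * l1 g.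
Proof. by rewrite /l1 !mxE !normrM mulrDr. Qed.

Definition affine_with g a := forall z w, a z = a w + dot g (z - w).

Lemma affine_Lip L g a : l1 g <= L -> affine_with g a -> Lip L a.
Proof.
move=> gL aff z w; rewrite (aff z w) addrAC subrr add0r.
by apply: le_trans (dot_le _ _) _; rewrite ler_wpM2r.
Qed.

Lemma affine_continuous g a : affine_with g a -> continuous a.
Proof. by move/(affine_Lip (lexx _))/Lip_continuous. Qed.

Lemma affine_convex_at g a z : affine_with g a -> convex_at a z.
Proof.
move=> aff; exists 1 => // x y _ _ t _.
have hx := aff x 0; have hy := aff y 0; rewrite !subr0 in hx hy.
rewrite (aff _ 0) subr0 dotD !dotZ hx hy le_eqVlt; apply/orP; left; apply/eqP.
ring.
Qed.

(** The bound on the gradients is part of the notion because a notch has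
gradients close to the convex hull of [g1] and [g2]: a strict inequality leaves
room for them below [L]. *)
Definition fold_point L f p := exists g1 g2, [/\ g1 <> g2, l1 g1 < L, l1 g2 < L &
  \forall z \near p, f z = f p + Num.min (dot g1 (z - p)) (dot g2 (z - p))].

Lemma fold_point_near L f h p : (\forall z \near p, f z = h z) ->
  fold_point L h p -> fold_point L f p.
Proof.
move=> fh [g1 [g2 [g12 g1L g2L hE]]]; exists g1, g2; split => //.
rewrite (nbhs_singleton fh); by apply: (@filterS2 _ (nbhs p) _ _ _ _ _ fh hE) => z ->.
Qed.

Lemma fold_point_min L g1 g2 a1 a2 p : g1 <> g2 -> l1 g1 < L -> l1 g2 < L ->
  affine_with g1 a1 -> affine_with g2 a2 -> a1 p = a2 p ->
  fold_point L (fun z => Num.min (a1 z) (a2 z)) p.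
Proof.
move=> g12 g1L g2L aff1 aff2 a12; exists g1, g2; split => //.
apply: (@filterE _ (nbhs p)) => z; rewrite a12 minxx (aff1 z p) (aff2 z p) a12.
by rewrite addr_minr.
Qed.

Definition min3 a1 a2 a3 z : R := Num.min (a1 z) (Num.min (a2 z) (a3 z)).

Definition tie a1 a2 a3 z := [\/ a1 z = a2 z /\ a1 z <= a3 z,
  a1 z = a3 z /\ a1 z <= a2 z | a2 z = a3 z /\ a2 z <= a1 z].

(** A minimum of three affine functions is singular only where the minimal
value is attained twice, and it has a fold there unless it is attained three
times. *)
Section Min3.
Context (L : R) (g1 g2 g3 : pt) (a1 a2 a3 : pt -> R).
Hypotheses (aff1 : affine_with g1 a1) (aff2 : affine_with g2 a2)
  (aff3 : affine_with g3 a3).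

Let c1 := affine_continuous aff1.
Let c2 := affine_continuous aff2.
Let c3 := affine_continuous aff3.

Lemma nonconvex_min3 z : nonconvex_pts (min3 a1 a2 a3) z -> tie a1 a2 a3 z.
Proof.
have s1 : a1 z < a2 z -> a1 z < a3 z -> convex_at (min3 a1 a2 a3) z.
  move=> /(lt_near c1 c2) h2 /(lt_near c1 c3) h3.
  apply: convex_at_near (affine_convex_at z aff1).
  move: h2 h3; apply: filterS2 => x; rewrite /min3 => *.
  by case: (ltP (a2 x) (a3 x)) => ?; rewrite min_l// ltW.
have s2 : a2 z < a1 z -> a2 z < a3 z -> convex_at (min3 a1 a2 a3) z.
  move=> /(lt_near c2 c1) h2 /(lt_near c2 c3) h3.
  apply: convex_at_near (affine_convex_at z aff2).
  move: h2 h3; apply: filterS2 => x; rewrite /min3 => ? /ltW/min_l ->.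
  by rewrite min_r// ltW.
have s3 : a3 z < a1 z -> a3 z < a2 z -> convex_at (min3 a1 a2 a3) z.
  move=> /(lt_near c3 c1) h2 /(lt_near c3 c2) h3.
  apply: convex_at_near (affine_convex_at z aff3).
  move: h2 h3; apply: filterS2 => x; rewrite /min3 => ? /ltW/min_r ->.
  by rewrite min_r// ltW.
move=> Sz.
case: (ltgtP (a1 z) (a2 z)) => h12; case: (ltgtP (a1 z) (a3 z)) => h13;
case: (ltgtP (a2 z) (a3 z)) => h23; try by exfalso; apply: Sz; auto.
all: try by exfalso; lra.
all: rewrite /tie; try by [constructor 1; split; lra].
all: try by [constructor 2; split; lra].
all: try by [constructor 3; split; lra].
Qed.

Hypotheses (g12 : g1 <> g2) (g13 : g1 <> g3) (g23 : g2 <> g3).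
Hypotheses (g1L : l1 g1 < L) (g2L : l1 g2 < L) (g3L : l1 g3 < L).

Lemma min3_Lip : Lip L (min3 a1 a2 a3).
Proof.
apply: Lip_min; first exact: affine_Lip (ltW g1L) aff1.
by apply: Lip_min; [exact: affine_Lip (ltW g2L) aff2|exact: affine_Lip (ltW g3L) aff3].
Qed.

Lemma fold_point_min3 z : tie a1 a2 a3 z -> ~ (a1 z = a2 z /\ a2 z = a3 z) ->
  fold_point L (min3 a1 a2 a3) z.
Proof.
move=> tz n3; case: tz => -[e l].
- have {}l : a1 z < a3 z.
    by rewrite lt_neqAle l andbT; apply/eqP => h; apply: n3; split=> //; lra.
  have l' : a2 z < a3 z by rewrite -e.
  apply: fold_point_near (fold_point_min g12 g1L g2L aff1 aff2 e).
  move: (lt_near c1 c3 l) (lt_near c2 c3 l'); apply: filterS2 => x h1.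
  by rewrite /min3 => /ltW/min_l ->.
- have {}l : a1 z < a2 z.
    by rewrite lt_neqAle l andbT; apply/eqP => h; apply: n3; split=> //; lra.
  have l' : a3 z < a2 z by rewrite -e.
  apply: fold_point_near (fold_point_min g13 g1L g3L aff1 aff3 e).
  move: (lt_near c1 c2 l) (lt_near c3 c2 l'); apply: filterS2 => x h1.
  by rewrite /min3 => /ltW/min_r ->.
- have {}l : a2 z < a1 z.
    by rewrite lt_neqAle l andbT; apply/eqP => h; apply: n3; split=> //; lra.
  have l' : a3 z < a1 z by rewrite -e.
  apply: fold_point_near (fold_point_min g23 g2L g3L aff2 aff3 e).
  move: (lt_near c2 c1 l) (lt_near c3 c1 l'); apply: filterS2 => x h1 h2.
  by rewrite /min3 min_r// ge_min ltW.
Qed.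

End Min3.

(** The second condition makes almost every line parallel to an axis meet the
singular set at finitely many points, and by the first one almost all of these
lines avoid the points that are not folds. *)
Definition tame L f := finite_set (nonconvex_pts f `\` fold_point L f) /\
  forall i : 'I_2,
    finite_set [set xi | ~ finite_set (nonconvex_pts f `&` [set z : pt | z 0 i = xi])].

(** The line [a = 0] meets [z_i = xi] at no more than one point, unless it is
parallel to it; then only one value of [xi] matters. *)
Lemma line_sections g a i : g <> 0 -> affine_with g a ->
  finite_set [set xi : R |
    ~ finite_set ([set z | a z = 0] `&` [set z : pt | z 0 i = xi])].
Proof.
move=> g0 aff.
have aE z : a z = a 0 + dot g z by rewrite (aff z 0) subr0.
have [j [k [jk hjk hd]]] : exists j k : 'I_2, [/\ j = i,
    forall z w : pt, z 0 j = w 0 j -> z 0 k = w 0 k -> z = w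
    & forall z, dot g z = g 0 j * z 0 j + g 0 k * z 0 k].
  move: i; apply: I2P; [exists 0, 1|exists 1, 0]; split => // z.
  - exact: rV2P.
  - by move=> w h1 h2; apply: rV2P.
  - by rewrite /dot addrC.
rewrite -{}jk; have [gk|gk] := eqVneq (g 0 k) 0; last first.
  apply: sub_finite_set (finite_set0 _) => xi /=; apply.
  have [[z0 [z0a z0x]]|ne] :=
      pselect (([set z | a z = 0] `&` [set z : pt | z 0 j = xi]) !=set0).
    apply: sub_finite_set (finite_set1 z0) => z [/= za zx].
    apply: hjk; first by rewrite zx z0x.
    move: za z0a; rewrite /= (aE z) (aE z0) !hd zx z0x => h1 h2.
    by apply: (mulfI gk); lra.
  by apply: sub_finite_set (finite_set0 _) => z hz; apply: ne; exists z.
have gj : g 0 j != 0.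
  apply/eqP => gj; apply: g0; apply: hjk; by rewrite mxE.
apply: sub_finite_set (finite_set1 (- a 0 / g 0 j)) => xi /= nf.
apply: contrapT => ne; apply: nf; apply: sub_finite_set (finite_set0 _) => z [/= za zx].
apply: ne; rewrite -zx; apply: (mulfI gj).
by rewrite mulrCA divff// mulr1; move: za; rewrite aE hd gk; lra.
Qed.

Section TameRaise.
Context (L : R) (f : pt -> R) (p : pt) (r : R).
Context (g1 g2 g3 : pt) (a1 a2 a3 : pt -> R).
Hypotheses (aff1 : affine_with g1 a1) (aff2 : affine_with g2 a2)
  (aff3 : affine_with g3 a3).
Hypotheses (g12 : g1 <> g2) (g13 : g1 <> g3) (g23 : g2 <> g3).
Hypotheses (g1L : l1 g1 < L) (g2L : l1 g2 < L) (g3L : l1 g3 < L).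
Hypotheses (r0 : 0 < r) (fL : Lip L f) (fG : tame L f).
Let Q := min3 a1 a2 a3.
Hypothesis Qlow : forall z, r / 4 <= `|z - p| -> `|z - p| < r -> Q z < f z.
Hypothesis finQ : finite_set [set z | [/\ `|z - p| < r, f z = Q z &
  nonconvex_pts f z \/ tie a1 a2 a3 z]].
Hypothesis fin3 : finite_set [set z | a1 z = a2 z /\ a2 z = a3 z].
Let QL : Lip L Q := min3_Lip aff1 aff2 aff3 g1L g2L g3L.

(** Off the boundary [f = Q] the raised function is locally [f] or [Q].  So
every new singular point that is not a fold was such a point for [f], or is an
apex of [Q], or is one of the finitely many singular points on that
boundary. *)
Lemma tame_raise : tame L (raise f Q p r).
Proof.
have tieQ := nonconvex_min3 aff1 aff2 aff3.
split.
  apply: (@sub_finite_set _ _ ((nonconvex_pts f `\` fold_point L f) `|`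
    [set z | a1 z = a2 z /\ a2 z = a3 z] `|`
    [set z | [/\ `|z - p| < r, f z = Q z &
      nonconvex_pts f z \/ tie a1 a2 a3 z]])); last first.
    by rewrite !finite_setU; split=> //; split=> //; case: fG.
  move=> z [Sz nR].
  case: (nonconvex_raise r0 fL QL Qlow Sz) => [[Sf Qf]|[SQ zp fQ]].
    have [zp|zp] := ltP `|z - p| r; last first.
      left; left; split=> // rf; apply: nR; apply: fold_point_near rf.
      by apply: (raise_near_out Qlow); move: zp r0; lra.
    move: Qf => /(_ zp); rewrite le_eqVlt => /orP[/eqP Qf|Qf].
      by right; split=> //; left.
    left; left; split=> // rf; apply: nR; apply: fold_point_near rf.
    exact: (raise_near_f fL QL).
  have zr : `|z - p| < r by move: zp r0; lra.
  move: fQ; rewrite le_eqVlt => /orP[/eqP Qf|Qf].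
    by right; split=> //; right; apply: tieQ.
  left; right; apply: contrapT => n3; apply: nR.
  apply: (fold_point_near (raise_near_Q fL QL zr Qf)).
  by apply: fold_point_min3 => //; apply: tieQ.
move=> i; pose F (A : set pt) := [set xi : R | ~ finite_set (A `&` [set z | z 0 i = xi])].
have FU A B : finite_set (F A) -> finite_set (F B) -> finite_set (F (A `|` B)).
  move=> fA fB; apply: (@sub_finite_set _ _ (F A `|` F B)); last by rewrite finite_setU.
  move=> xi /=; rewrite /F /= setIUl finite_setU => nAB.
  by apply: contrapT => /not_orP[/contrapT hA /contrapT hB]; apply: nAB.
have Fsub A B : A `<=` B -> finite_set (F B) -> finite_set (F A).
  move=> AB; apply: sub_finite_set => xi /= nA fB; apply: nA.
  by apply: sub_finite_set fB => z [/AB].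
have Fline g h a b : g <> h -> affine_with g a -> affine_with h b ->
    finite_set (F [set z | a z = b z]).
  move=> gh affa affb.
  apply: (@Fsub _ [set z | a z - b z = 0]); first by move=> z /= ->; rewrite subrr.
  apply: (@line_sections (g - h) (fun z => a z - b z)).
    by move=> /eqP; rewrite subr_eq0 => /eqP.
  by move=> z w; rewrite (affa z w) (affb z w) /dot !mxE; ring.
apply: (@Fsub _ (nonconvex_pts f `|` ([set z | a1 z = a2 z] `|`
   ([set z | a1 z = a3 z] `|` [set z | a2 z = a3 z])))).
  move=> z /(nonconvex_raise r0 fL QL Qlow) [[Sf _]|[/tieQ SQ _ _]]; first by left.
  by right; case: SQ => -[h _]; [left|right; left|right; right].
apply: (FU _ _); first by case: fG => _; apply.
apply: (FU _ _); first exact: Fline aff1 aff2.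
by apply: (FU _ _); [exact: Fline aff1 aff3|exact: Fline aff2 aff3].
Qed.

End TameRaise.

End Plane.

(** * Notching a fold *)

Section Notch.
Context {R : realType}.
Local Notation pt := 'rV[R]_2.
Implicit Types (f Q a : pt -> R) (p z w g h e : pt) (L : R).

Lemma affine_center g p (c : R) : affine_with g (fun z => c + dot g (z - p)).
Proof. by move=> z w; rewrite /dot !mxE; ring. Qed.

Lemma nonconvex_fold f p (r : R) g1 g2 z :
  (forall x, `|x - p| < r ->
    f x = f p + Num.min (dot g1 (x - p)) (dot g2 (x - p))) ->
  `|z - p| < r -> nonconvex_pts f z -> dot g1 (z - p) = dot g2 (z - p).
Proof.
move=> fE zr Sz.
have near_r := near_dist_lt zr.
have aff g : affine_with g (fun x => f p + dot g (x - p)) by exact: affine_center.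
have ca g := affine_continuous (aff g).
apply: contrapT => ne; apply: Sz.
have [|] := ltP (dot g1 (z - p)) (dot g2 (z - p)) => lt12.
  have l : f p + dot g1 (z - p) < f p + dot g2 (z - p) by rewrite ltrD2l.
  apply: convex_at_near (affine_convex_at z (aff g1)).
  move: near_r (lt_near (ca g1) (ca g2) l); apply: filterS2 => x xr.
  by rewrite ltrD2l => /ltW/min_l xl; rewrite fE// xl.
have l : f p + dot g2 (z - p) < f p + dot g1 (z - p).
  by rewrite ltrD2l lt_neqAle lt12 andbT; apply/eqP => h; apply: ne.
apply: convex_at_near (affine_convex_at z (aff g2)).
move: near_r (lt_near (ca g2) (ca g1) l); apply: filterS2 => x xr.
by rewrite ltrD2l => /ltW/min_r xl; rewrite fE// xl.
Qed.

Definition det2 g h : R := g 0 0 * h 0 1 - g 0 1 * h 0 0.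

Lemma dot2_inj h e z w : det2 h e != 0 -> dot h z = dot h w -> dot e z = dot e w ->
  z = w.
Proof.
rewrite /det2 /dot => d hz ez; apply: rV2P; apply: (mulfI d).
  have -> : forall x : pt, (h 0 0 * e 0 1 - h 0 1 * e 0 0) * x 0 0 =
    e 0 1 * (h 0 0 * x 0 0 + h 0 1 * x 0 1) - h 0 1 * (e 0 0 * x 0 0 + e 0 1 * x 0 1).
    by move=> x; ring.
  by rewrite hz ez; ring.
have -> : forall x : pt, (h 0 0 * e 0 1 - h 0 1 * e 0 0) * x 0 1 =
  h 0 0 * (e 0 0 * x 0 0 + e 0 1 * x 0 1) - e 0 0 * (h 0 0 * x 0 0 + h 0 1 * x 0 1).
  by move=> x; ring.
by rewrite hz ez; ring.
Qed.

Lemma dot2_bound h e : det2 h e != 0 -> exists2 C : R, 0 < C &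
  forall w (s : R), 0 < s -> `|dot h w| <= s -> `|dot e w| <= s -> `|w| < C * s.
Proof.
move=> d; have d0 : 0 < `|det2 h e| by rewrite normr_gt0.
pose K := l1 h + l1 e + 1.
have K0 : 0 < K by rewrite /K; have := l1_ge0 h; have := l1_ge0 e; lra.
exists (K / `|det2 h e|); first by rewrite divr_gt0.
move=> w s s0 hw ew.
have key (a b x : R) : det2 h e * x = a * dot e w + b * dot h w ->
    `|a| <= l1 h + l1 e - `|b| -> `|x| < K / `|det2 h e| * s.
  move=> xE ab; rewrite mulrAC ltr_pdivlMr// mulrC -normrM xE.
  apply: le_lt_trans (ler_normD _ _) _; rewrite !normrM.
  have h1 : `|a| * `|dot e w| <= `|a| * s by rewrite ler_wpM2l.
  have h2 : `|b| * `|dot h w| <= `|b| * s by rewrite ler_wpM2l.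
  have h3 : `|a| * s <= (l1 h + l1 e - `|b|) * s by rewrite ler_wpM2r// ltW.
  by rewrite /K; nra.
have n1 := normr_ge0 (h 0 0); have n2 := normr_ge0 (h 0 1).
have n3 := normr_ge0 (e 0 0); have n4 := normr_ge0 (e 0 1).
apply: norm_lt_coord.
  apply: (key (- h 0 1) (e 0 1)); first by rewrite /det2 /dot; ring.
  by rewrite normrN /l1; lra.
apply: (key (h 0 0) (- e 0 0)); first by rewrite /det2 /dot; ring.
by rewrite normrN /l1; lra.
Qed.

(** The functional [e] measures position along the fold [h = 0], in the
direction of increasing [i]-th coordinate.  A small multiple of that coordinate
itself works, unless it is constant on the fold, in which case the last
requirement is void and the other coordinate will do. *)
Lemma transverse h (i : 'I_2) (d : R) : h != 0 -> 0 < d ->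
  exists e, [/\ l1 e < d, det2 h e != 0 &
    forall w, dot h w = 0 -> w 0 i < 0 -> dot e w < 0].
Proof.
move=> h0 d0.
pose e k : pt := \row_j (d / 2 * (j == k)%:R).
have le k : l1 (e k) < d.
  rewrite /l1 !mxE; move: k; apply: I2P; rewrite /= mulr0 mulr1 normr0 ?(addr0, add0r).
    by rewrite gtr0_norm; lra.
  by rewrite gtr0_norm; lra.
have h01 : h 0 0 != 0 \/ h 0 1 != 0.
  have [h00|] := eqVneq (h 0 0) 0; last by left.
  right; apply: contraNneq h0 => h1; apply/eqP; apply: rV2P; by rewrite mxE.
have d20 : d / 2 != 0 by rewrite gt_eqF// divr_gt0.
move: i; apply: I2P.
- have [h1|h1] := eqVneq (h 0 1) 0.
    have h00 : h 0 0 != 0 by case: h01 => //; rewrite h1 eqxx.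
    exists (e 1); split=> //.
      by rewrite /det2 !mxE /= h1 mul0r subr0 mulr1 mulf_neq0.
    move=> w /eqP; rewrite /dot h1 mul0r addr0 mulf_eq0 (negbTE h00) /= => /eqP ->.
    by rewrite ltxx.
  exists (e 0); split=> //.
    by rewrite /det2 !mxE /= mulr0 mulr0 sub0r oppr_eq0 mulr1 mulf_neq0.
  by move=> w _ w0; rewrite /dot !mxE /= mulr0 mul0r addr0 mulr1 pmulr_rlt0// divr_gt0.
- have [h1|h1] := eqVneq (h 0 0) 0.
    have h00 : h 0 1 != 0 by case: h01 => //; rewrite h1 eqxx.
    exists (e 0); split=> //.
      by rewrite /det2 !mxE /= h1 mul0r sub0r oppr_eq0 mulr1 mulf_neq0.
    move=> w /eqP; rewrite /dot h1 mul0r add0r mulf_eq0 (negbTE h00) /= => /eqP ->.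
    by rewrite ltxx.
  exists (e 1); split=> //.
    by rewrite /det2 !mxE /= mulr0 mulr0 subr0 mulr1 mulf_neq0.
  by move=> w _ w0; rewrite /dot !mxE /= mulr0 mul0r add0r mulr1 pmulr_rlt0// divr_gt0.
Qed.

(** Here [Num.min u (- u)] is the fold and [Num.min b1 (Num.min b2 b3)] the
pyramid of the notch, in coordinates [u] across the fold and [v] along it.  The
pyramid exceeds the fold exactly for [- al - |u| < v < al - 2 * |u|]. *)
Section Profile.
Context (al mu u v : R).
Hypothesis mu0 : 0 < mu.
Let b1 := al + v.
Let b2 := mu * al - mu * v - (1 + 2 * mu) * u.
Let b3 := mu * al - mu * v + (1 + 2 * mu) * u.

Lemma profile_bound : Num.min u (- u) <= Num.min b1 (Num.min b2 b3) ->
  `|u| <= 3 * al /\ `|v| <= 3 * al.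
Proof.
rewrite !le_min => /and3P[h1 h2 h3].
have [u0|u0] := leP 0 u.
  have mE : Num.min u (- u) = - u by rewrite min_r//; lra.
  rewrite mE in h1 h2 h3.
  have : 0 <= mu * (al - v - 2 * u) by move: h2; rewrite /b2; lra.
  by rewrite pmulr_rge0// !ler_norml; move: h1; rewrite /b1; lra.
have mE : Num.min u (- u) = u by rewrite min_l//; lra.
rewrite mE in h1 h2 h3.
have : 0 <= mu * (al - v + 2 * u) by move: h3; rewrite /b3; lra.
by rewrite pmulr_rge0// !ler_norml; move: h1; rewrite /b1; lra.
Qed.

(** The three points are the upper end of the tail and the feet of the two
legs. *)
Lemma profile_tie : Num.min u (- u) = Num.min b1 (Num.min b2 b3) ->
  [\/ b1 = b2 /\ b1 <= b3, b1 = b3 /\ b1 <= b2 | b2 = b3 /\ b2 <= b1] ->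
  [\/ u = 0 /\ v = al, u = 2 * al /\ v = - 3 * al | u = - 2 * al /\ v = - 3 * al].
Proof.
have mu12 : 0 < 1 + 2 * mu by move: mu0; lra.
move=> E; case=> -[e l].
- have u0 : 0 <= u.
    have : 0 <= (1 + 2 * mu) * u by move: e l; rewrite /b1 /b2 /b3; lra.
    by rewrite pmulr_rge0.
  have : - u = b1.
    by move: E; rewrite min_r; [move=> ->; rewrite -e min_l// le_min lexx|lra].
  move=> uE; have : mu * (al - v - 2 * u) = 0 by move: e uE; rewrite /b1 /b2; lra.
  move=> /eqP; rewrite mulf_eq0 gt_eqF//= => /eqP h.
  by constructor 2; move: uE h; rewrite /b1; lra.
- have u0 : u <= 0.
    have : (1 + 2 * mu) * u <= 0 by move: e l; rewrite /b1 /b2 /b3; lra.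
    by rewrite pmulr_rle0.
  have : u = b1.
    move: E; rewrite min_l; last by lra.
    by move=> ->; rewrite -e min_l// le_min l lexx.
  move=> uE; have : mu * (al - v + 2 * u) = 0 by move: e uE; rewrite /b1 /b3; lra.
  move=> /eqP; rewrite mulf_eq0 gt_eqF//= => /eqP h.
  by constructor 3; move: uE h; rewrite /b1; lra.
- have /eqP : (1 + 2 * mu) * u = 0 by move: e; rewrite /b2 /b3; lra.
  rewrite mulf_eq0 gt_eqF//= => /eqP u0; constructor 1; split=> //.
  have : mu * (al - v) = 0.
    move: E; rewrite -e minxx (min_r l).
    by rewrite u0 oppr0 minxx /b2 u0; lra.
  by move=> /eqP; rewrite mulf_eq0 gt_eqF//= => /eqP; lra.
Qed.

Lemma profile_fold : Num.min u (- u) = Num.min b1 (Num.min b2 b3) -> u = 0 ->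
  v = - al \/ v = al.
Proof.
move=> + u0; rewrite /b1 /b2 /b3 u0 oppr0 minxx mulr0 subr0 addr0 minxx.
have [h E|h E] := leP (al + v) (mu * al - mu * v); first by left; lra.
have : mu * (al - v) = 0 by lra.
by move=> /eqP; rewrite mulf_eq0 gt_eqF//= => /eqP ?; right; lra.
Qed.

Lemma profile_apex : b1 = b2 -> b2 = b3 ->
  u = 0 /\ v = - ((1 - mu) * al / (1 + mu)).
Proof.
rewrite /b1 /b2 /b3 => h12 h23.
have /eqP : (1 + 2 * mu) * u = 0 by lra.
rewrite mulf_eq0 gt_eqF//=; last by move: mu0; lra.
move=> /eqP u0; split=> //; rewrite u0 in h12.
have mu10 : 1 + mu != 0 by rewrite gt_eqF//; move: mu0; lra.
by apply: (mulfI mu10); rewrite mulrN mulrCA divff// mulr1; lra.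
Qed.

End Profile.

(** The function [Q] has the profile studied above, added to the mean of the
two affine pieces.  The last clause concerns the lower half [v < 0] of the fold:
on the whole fold, the only singular point of [Q] with [f = Q] is the upper end
[v = al] of the tail. *)
Lemma notch L f p (r : R) g1 g2 (i : 'I_2) : 0 < r -> Lip L f -> tame L f ->
  g1 <> g2 -> l1 g1 < L -> l1 g2 < L ->
  (forall x, `|x - p| < r ->
    f x = f p + Num.min (dot g1 (x - p)) (dot g2 (x - p))) ->
  exists Q, [/\ Lip L Q,
    forall z, r / 4 <= `|z - p| -> `|z - p| < r -> Q z < f z,
    tame L (raise f Q p r),
    f p < Q p &
    forall z, `|z - p| < r -> dot g1 (z - p) = dot g2 (z - p) ->
      z 0 i < p 0 i -> nonconvex_pts Q z -> f z <> Q z].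
Proof.
move=> r0 fL fG g12 g1L g2L fE.
pose m := 2^-1 *: (g1 + g2); pose h := 2^-1 *: (g1 - g2).
have h0 : h != 0.
  rewrite scaler_eq0 invr_eq0 (negbTE (_ : 2 != 0)) ?pnatr_eq0//= subr_eq0.
  by apply/eqP.
have hm : m + h = g1 /\ m - h = g2.
  by split; apply: rV2P; rewrite !mxE; field.
(* [d] is the room available for the gradients of the notch. *)
pose d := L - Num.max (l1 g1) (l1 g2).
have d0 : 0 < d by rewrite subr_gt0 gt_max g1L.
have d1 : l1 g1 <= L - d by rewrite /d opprB addrC subrK le_max lexx.
have d2 : l1 g2 <= L - d by rewrite /d opprB addrC subrK le_max lexx orbT.
have lm : l1 m <= L - d.
  by rewrite /m l1Z gtr0_norm ?invr_gt0//; have := l1D g1 g2; lra.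
clearbody m h d.
have [e [ed he eh]] := transverse i h0 d0.
have [C C0 CP] := dot2_bound he.
pose K := 2 * l1 h + l1 e + 1.
have K0 : 0 < K by rewrite /K; have := l1_ge0 h; have := l1_ge0 e; lra.
(* This [mu] is below 1 and also makes the change of [g1] and [g2] below [d]. *)
pose mu := d / (d + K).
have dK0 : 0 < d + K by rewrite addr_gt0.
have muE : mu * (d + K) = d by rewrite divfK// gt_eqF.
have mu0 : 0 < mu by rewrite divr_gt0.
have mu1 : mu < 1 by move: muE K0 d0 mu0; clearbody mu; nra.
have muK : mu * K < d by move: muE (mulr_gt0 mu0 d0); lra.
(* The notch must fit in the ball of radius [r / 4]. *)
pose al := r / (12 * C + 1).
have C10 : 0 < 12 * C + 1 by lra.
have al0 : 0 < al by rewrite divr_gt0.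
have alC : C * (3 * al) < r / 4.
  have : al * (12 * C + 1) = r by rewrite divfK// gt_eqF.
  nra.
pose G1 := m + e.
pose G2 := m - mu *: e - (1 + 2 * mu) *: h.
pose G3 := m - mu *: e + (1 + 2 * mu) *: h.
pose a1 z := f p + al + dot G1 (z - p).
pose a2 z := f p + mu * al + dot G2 (z - p).
pose a3 z := f p + mu * al + dot G3 (z - p).
have aff1 : affine_with G1 a1 by exact: affine_center.
have aff2 : affine_with G2 a2 by exact: affine_center.
have aff3 : affine_with G3 a3 by exact: affine_center.
have lmu : `|mu| * l1 (2 *: h + e) < d.
  apply: le_lt_trans muK; rewrite gtr0_norm// ler_wpM2l// ?(ltW mu0)//.
  by rewrite (le_trans (l1D _ _))// l1Z ger0_norm//; rewrite /K; lra.
have G1L : l1 G1 < L.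
  by have := l1D m e; rewrite /G1; lra.
have G2L : l1 G2 < L.
  have -> : G2 = g2 + (- mu) *: (2 *: h + e).
    by apply: rV2P; rewrite -hm.2 !mxE; ring.
  by apply: le_lt_trans (l1D _ _) _; rewrite l1Z normrN; lra.
have G3L : l1 G3 < L.
  have -> : G3 = g1 + mu *: (2 *: h - e).
    by apply: rV2P; rewrite -hm.1 !mxE; ring.
  apply: le_lt_trans (l1D _ _) _; rewrite l1Z.
  have : l1 (2 *: h - e) <= 2 * l1 h + l1 e.
    have := l1D (2 *: h) (-1 *: e); rewrite !l1Z normrN1 mul1r scaleN1r.
    by rewrite ger0_norm.
  have : mu * l1 (2 *: h - e) <= mu * (2 * l1 h + l1 e) -> mu * l1 (2 *: h - e) < d.
    by move=> ?; move: muK; rewrite /K; lra.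
  move=> H1 H2; rewrite (gtr0_norm mu0); have := H1 (ler_wpM2l (ltW mu0) H2); lra.
have detne (t x : R) g g' : x != 0 -> g - g' = t *: h + x *: e -> g <> g'.
  move=> x0 gE gg; rewrite gg subrr in gE; move/eqP: he; apply.
  have := congr1 (fun w : pt => w 0 0) gE; have := congr1 (fun w : pt => w 0 1) gE.
  rewrite !mxE /det2 => e1 e0.
  apply: (mulfI x0); rewrite mulr0.
  have -> : x * (h 0 0 * e 0 1 - h 0 1 * e 0 0) =
    h 0 0 * (t * h 0 1 + x * e 0 1) - h 0 1 * (t * h 0 0 + x * e 0 0) by ring.
  by rewrite -e1 -e0; ring.
have G12 : G1 <> G2.
  apply: (detne (1 + 2 * mu) (1 + mu)); first by rewrite gt_eqF//; lra.
  by apply: rV2P; rewrite /G1 /G2 !mxE; ring.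
have G13 : G1 <> G3.
  apply: (detne (- (1 + 2 * mu)) (1 + mu)); first by rewrite gt_eqF//; lra.
  by apply: rV2P; rewrite /G1 /G3 !mxE; ring.
have G23 : G2 <> G3.
  move=> GE; move/eqP: h0; apply.
  have e2 : (2 * (1 + 2 * mu)) *: h = 0.
    have -> : (2 * (1 + 2 * mu)) *: h = G3 - G2.
      by apply: rV2P; rewrite /G3 /G2 !mxE; ring.
    by rewrite GE subrr.
  move/eqP: e2; rewrite scaler_eq0 gt_eqF//=; last by lra.
  by move/eqP.
pose u z := dot h (z - p); pose v z := dot e (z - p).
pose M z := f p + dot m (z - p).
have a1E z : a1 z = M z + (al + v z) by rewrite /a1 /M /v /dot /G1 !mxE; ring.
have a2E z : a2 z = M z + (mu * al - mu * v z - (1 + 2 * mu) * u z).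
  by rewrite /a2 /M /v /u /dot /G2 !mxE; ring.
have a3E z : a3 z = M z + (mu * al - mu * v z + (1 + 2 * mu) * u z).
  by rewrite /a3 /M /v /u /dot /G3 !mxE; ring.
have g1E z : dot g1 (z - p) = dot m (z - p) + u z.
  by rewrite /u -hm.1 /dot !mxE; ring.
have g2E z : dot g2 (z - p) = dot m (z - p) - u z.
  by rewrite /u -hm.2 /dot !mxE; ring.
have fME z : `|z - p| < r -> f z = M z + Num.min (u z) (- u z).
  by move=> zr; rewrite fE// g1E g2E -addr_minr addrA.
pose Q := min3 a1 a2 a3.
have QE z : Q z = M z + Num.min (al + v z)
    (Num.min (mu * al - mu * v z - (1 + 2 * mu) * u z)
      (mu * al - mu * v z + (1 + 2 * mu) * u z)).
  by rewrite /Q /min3 a1E a2E a3E -!addr_minr.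
have tieE z : tie a1 a2 a3 z -> `|z - p| < r -> f z = Q z ->
  [\/ u z = 0 /\ v z = al, u z = 2 * al /\ v z = - 3 * al
    | u z = - 2 * al /\ v z = - 3 * al].
  move=> t zr; rewrite fME// QE => /addrI fQ; apply: profile_tie fQ _ => //.
  case: t; rewrite a1E a2E a3E => -[/addrI ? ]; rewrite lerD2l => ?;
    by [constructor 1|constructor 2|constructor 3].
have zuv z z' : u z = u z' -> v z = v z' -> z = z'.
  by move=> uz vz; apply: (addIr (- p)); apply: dot2_inj he uz vz.
have fin_uv (x y : R) : finite_set [set z | u z = x /\ v z = y].
  have [[z0 [uz vz]]|ne] := pselect ([set z | u z = x /\ v z = y] !=set0).
    apply: sub_finite_set (finite_set1 z0) => z [uz' vz'].
    by apply: zuv; [rewrite uz|rewrite vz].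
  by apply: sub_finite_set (finite_set0 _) => z hz; apply: ne; exists z.
have Qlow z : r / 4 <= `|z - p| -> `|z - p| < r -> Q z < f z.
  move=> z4 zr; rewrite ltNge; apply/negP; rewrite fME// QE lerD2l => hQ.
  have [hu hv] := profile_bound mu0 hQ.
  have al30 : 0 < 3 * al by rewrite mulr_gt0.
  by have := CP _ _ al30 hu hv; lra.
exists Q; split=> //.
- exact: min3_Lip aff1 aff2 aff3 G1L G2L G3L.
- apply: (@tame_raise _ L f p r G1 G2 G3) => //.
    apply: (@sub_finite_set _ _ ([set z | u z = 0 /\ v z = al] `|`
      [set z | u z = 2 * al /\ v z = - 3 * al] `|`
      [set z | u z = - 2 * al /\ v z = - 3 * al] `|`
      [set z | u z = 0 /\ v z = - al])); last by rewrite !finite_setU.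
    move=> z [zr fQ [Sz|tz]]; last first.
      by case: (tieE z tz zr fQ) => ?; left; [left; left|left; right|right].
    have := nonconvex_fold fE zr Sz; rewrite g1E g2E => hu.
    have {hu}uz : u z = 0 by lra.
    move: fQ; rewrite fME// -/Q QE => /addrI/profile_fold => /(_ mu0 uz).
    by case=> vz; [right|left; left; left].
  apply: sub_finite_set (fin_uv 0 (- ((1 - mu) * al / (1 + mu)))) => z /=.
  rewrite a1E a2E a3E => -[/addrI h12 /addrI h23].
  by have [] := profile_apex mu0 h12 h23.
- rewrite QE; have up : u p = 0 by rewrite /u subrr /dot !mxE !mulr0 addr0.
  have vp : v p = 0 by rewrite /v subrr /dot !mxE !mulr0 addr0.
  rewrite up vp !mulr0 !subr0 !addr0 minxx /M subrr.
  have -> : dot m 0 = 0 by rewrite /dot !mxE !mulr0 addr0.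
  by rewrite addr0 ltrDl lt_min al0 mulr_gt0.
- move=> z zr gz zi Sz fQ.
  have uz : u z = 0 by move: gz; rewrite g1E g2E; lra.
  have vz : v z < 0.
    by apply: eh => //; rewrite !mxE; lra.
  have := tieE z (nonconvex_min3 aff1 aff2 aff3 Sz) zr fQ.
  by case=> -[]; lra.
Qed.

End Notch.

(** * Cutting the singular set along a line *)

Section Cut.
Context {R : realType}.
Local Notation pt := 'rV[R]_2.
Implicit Types (f Q a : pt -> R) (p z w g h e : pt) (L : R).

Lemma open_lt_fun (f g : pt -> R) : continuous f -> continuous g ->
  open [set z | f z < g z].
Proof.
by move=> cf cg; rewrite openE => z fg; have := lt_near cf cg fg.
Qed.

Lemma closed_le_fun (f g : pt -> R) : continuous f -> continuous g ->
  closed [set z | f z <= g z].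
Proof.
move=> cf cg; rewrite (_ : [set z | _] = ~` [set z | g z < f z]).
  by apply: open_closedC; apply: open_lt_fun.
by apply/seteqP; split => z /=; rewrite leNgt => /negP.
Qed.

Lemma cst_continuous_pt (c : R) : continuous (fun _ : pt => c).
Proof. by apply: (@Lip_continuous _ _ 0) => x y; rewrite subrr normr0 mul0r. Qed.

(** [p] is a fold on the cutting line [z_i = xi], from which [A] departs on one
side of the line and [B] on the other.  The condition is local and concerns
inclusions only, hence is not affected by notches made at other points. *)
Definition cut_fold L f (A B : set pt) (i : 'I_2) (xi : R) p :=
  exists g1 g2 (r : R), [/\ 0 < r, g1 <> g2, l1 g1 < L & l1 g2 < L] /\
  forall z, `|z - p| < r ->
    [/\ f z = f p + Num.min (dot g1 (z - p)) (dot g2 (z - p)),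
        A z -> dot g1 (z - p) = dot g2 (z - p) /\ z 0 i < xi
      & B z -> dot g1 (z - p) = dot g2 (z - p) /\ xi < z 0 i].

(** By induction on the number of folds that still connect [A] and [B].
Notching [p] removes the piece [D] of the fold around [p]; the new singular
points [K] are attached to [B] and stay away from what remains of [A]. *)
Lemma cut_points L (i : 'I_2) (xi : R) (OA OB : set pt) (P : seq pt) f (A B : set pt) :
  open OA -> open OB -> uniq P -> Lip L f -> tame L f ->
  nonconvex_pts f `<=` A `|` B `|` [set` P] ->
  closed (A `|` [set` P]) -> closed (B `|` [set` P]) ->
  (forall z, A z -> ~ B z) ->
  A `<=` OA -> B `<=` OB -> [set` P] `<=` OA `&` OB ->
  (forall p, p \in P -> p 0 i = xi /\ cut_fold L f A B i xi p) ->
  exists f' A' B', [/\ [/\ Lip L f', tame L f', (forall z, f z <= f' z) &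
      forall z, ~ (OA `&` OB) z -> f' z = f z],
    nonconvex_pts f' `<=` A' `|` B', closed A', closed B' &
    [/\ forall z, A' z -> ~ B' z, A' `<=` OA & B' `<=` OB]].
Proof.
move=> oOA oOB; elim: P f A B => [|p P IH] f A B.
  rewrite set_nil !setU0 => _ fL fG SAB cA cB AB AO BO _ _.
  by exists f, A, B; split.
move=> /= /andP[pP uP] fL fG SAB cA cB AB AO BO PO Pfold.
have [pxi [g1 [g2 [r1 [[r10 g12 g1L g2L] pf]]]]] := Pfold p (mem_head _ _).
have [r [r0 rP rO rr1]] : exists r : R, [/\ 0 < r,
    forall q, q \in P -> r <= `|q - p|,
    forall z, `|z - p| < r -> OA z /\ OB z & r <= r1].
  have oU : open (OA `&` OB `&` ~` [set` P]).
    apply: openI; first exact: openI.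
    apply: closed_openC.
    apply: (accessible_finite_set_closed.1 (hausdorff_accessible _)).
      exact: (@norm_hausdorff R pt).
    by apply/finite_seqP; exists P.
  have : nbhs p (OA `&` OB `&` ~` [set` P]).
    apply: open_nbhs_nbhs; split=> //; split; last by apply/negP.
    by apply: PO; rewrite /= mem_head.
  move=> /nbhs_ballP[/= r2 r20 r2P]; exists (Num.min r1 r2); split.
  - by rewrite lt_min r10.
  - move=> q qP; rewrite leNgt; apply/negP; rewrite lt_min => /andP[_ qr2].
    have bq : ball p r2 q by rewrite -ball_normE /= distrC.
    by have [_ /(_ qP)] := r2P q bq.
  - move=> z; rewrite lt_min => /andP[_ zr2].
    have bz : ball p r2 z by rewrite -ball_normE /= distrC.
    by have [] := r2P z bz.
  - by rewrite ge_min lexx.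
have fE x : `|x - p| < r -> f x = f p + Num.min (dot g1 (x - p)) (dot g2 (x - p)).
  by move=> xr; have [] := pf x (lt_le_trans xr rr1).
have [Q [QL Qlow G' fQp Qcrest]] := notch i r0 fL fG g12 g1L g2L fE.
have r4 : r / 4 < r by move: r0; lra.
pose D : set pt := [set z | `|z - p| < r] `&` [set z | f z < Q z].
pose K : set pt :=
  [set z | nonconvex_pts Q z] `&` [set z | `|z - p| <= r / 4] `&` [set z | f z <= Q z].
have cf := Lip_continuous fL; have cQ := Lip_continuous QL.
have cd := @dist_continuous R pt p.
have oD : open D.
  by apply: openI; [exact: open_lt_fun cd (@cst_continuous_pt r)|exact: open_lt_fun].
have cK : closed K.
  apply: closedI; last exact: closed_le_fun.
  apply: closedI; first exact: nonconvex_closed.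
  by exact: closed_le_fun cd (@cst_continuous_pt (r / 4)).
have Dp : D p by split => //=; rewrite subrr normr0.
have PD q : q \in P -> ~ D q by move=> /rP; rewrite leNgt => /negP h [].
have minusD (C : set pt) : (C `\` D) `|` [set` P] = (C `|` [set` p :: P]) `\` D.
  apply/seteqP; split => z.
    by case=> [[Cz Dz]|zP]; split; [left| |right; rewrite /= inE zP orbT|exact: PD].
  move=> [[Cz|zP] Dz]; first by left.
  by move: zP; rewrite /= inE => /orP[/eqP zp|zP]; [rewrite zp in Dz|right].
have [||||||||||f' [A' [B' [[f'L f'G ff' f'out] SA' cA' cB' rest]]]] :=
    IH (raise f Q p r) (A `\` D) ((B `\` D) `|` K) uP => //.
- exact: raise_Lip r0 fL QL Qlow.
- move=> z /(nonconvex_raise r0 fL QL Qlow) [[Sf Qf]|[SQ zp fQ]]; last first.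
    by left; right; right; split=> //; split=> //=; exact: ltW.
  have nD : ~ D z by move=> [zr]; rewrite /= ltNge Qf.
  have [[Az|Bz]|/=] := SAB z Sf; first by left; left.
    by left; right; left.
  by rewrite inE => /orP[/eqP zp|zP]; [rewrite zp in nD|right].
- by rewrite minusD; apply: closedI => //; exact: open_closedC.
- rewrite setUAC minusD; apply: closedU => //.
  by apply: closedI => //; exact: open_closedC.
- move=> z [Az nD] [[Bz _]|[[SQ zp] fQ]]; first exact: AB Az Bz.
  have zr : `|z - p| < r by apply: le_lt_trans zp r4.
  have [_ /(_ Az) [gz zi] _] := pf z (lt_le_trans zr rr1).
  apply: (Qcrest z zr gz _ SQ); first by rewrite pxi.
  apply/eqP; rewrite eq_le fQ /= leNgt; apply/negP => lt; exact: nD.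
- by move=> z [/AO].
- move=> z [[/BO]//|[[_ zp] _]].
  by have [] := rO z (le_lt_trans zp r4).
- by move=> z zP; apply: PO; rewrite /= inE zP orbT.
- move=> q qP; have qpP : q \in p :: P by rewrite inE qP orbT.
  have [qxi [h1 [h2 [r2 [hs qf]]]]] := Pfold q qpP; split=> //.
  have qr := rP q qP.
  exists h1, h2, (Num.min r2 (`|q - p| - r / 4)); split.
    by case: hs => ? ? ? ?; split => //; rewrite lt_min; apply/andP; split; lra.
  move=> z; rewrite lt_min => /andP[zr2 zq].
  have zp : r / 4 < `|z - p|.
    have : `|q - p| <= `|z - q| + `|z - p|.
      by rewrite (distrC z q) (le_trans _ (ler_normD _ _))// subrKA.
    lra.
  have [fz Az Bz] := qf z zr2; split.
  + by rewrite !(raise_out Qlow) ?ltW//; lra.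
  + by move=> [/Az].
  + by move=> [[/Bz]//|[[_ /=]]]; rewrite leNgt zp.
- exists f', A', B'; split=> //; split=> //.
    by move=> z; apply: le_trans (ff' z); apply: raise_ge.
  move=> z nO; rewrite f'out//; apply: (raise_out Qlow).
  rewrite leNgt; apply/negP => zp; apply: nO.
  by have [] := rO z (lt_trans zp r4).
Qed.

(** Almost every [xi] between [s] and [t] gives a line that meets the singular
set at finitely many folds only. *)
Lemma cut_strip L f (U : set pt) (i : 'I_2) (s t : R) : Lip L f -> tame L f ->
  open U -> nonconvex_pts f `<=` U -> s < t ->
  exists f' A B, [/\ [/\ Lip L f', tame L f', (forall z, f z <= f' z) &
      forall z, ~ U z -> f' z = f z],
    nonconvex_pts f' `<=` A `|` B, closed A, closed B &
    [/\ forall z, A z -> ~ B z, A `<=` U `&` [set z | z 0 i < t]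
      & B `<=` U `&` [set z | s < z 0 i]]].
Proof.
move=> fL fG oU SU st.
have [xi [/andP[sxi xit] finxi nb]] : exists xi : R, [/\ s < xi < t,
    finite_set (nonconvex_pts f `&` [set z : pt | z 0 i = xi]) &
    forall z, nonconvex_pts f z -> z 0 i = xi -> fold_point L f z].
  have [finV finL] := fG.
  apply: contrapT => nex.
  have : finite_set `]s, t[.
    apply: (@sub_finite_set _ _
      ([set xi | ~ finite_set (nonconvex_pts f `&` [set z : pt | z 0 i = xi])] `|`
       [set z 0 i | z in nonconvex_pts f `\` fold_point L f])); last first.
      by rewrite finite_setU; split; [exact: finL|exact: finite_image].
    move=> xi; rewrite /= in_itv /= => xist; apply: contrapT => /not_orP[h1 h2].
    apply: nex; exists xi; split => //; first exact: contrapT.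
    by move=> z Sz zi; apply: contrapT => nR; apply: h2; exists z.
  (* An open interval is infinite. *)
  pose F (n : nat) : R := s + (t - s) / n.+2%:R.
  have Finj : {in F @^-1` `]s, t[%classic &, injective F}.
    move=> m n _ _ /addrI /mulfI => /(_ ltac:(by rewrite subr_eq0 gt_eqF))/invr_inj/eqP.
    by rewrite eqr_nat => /eqP[].
  move=> /(finite_preimage Finj).
  rewrite (_ : _ @^-1` _ = setT); first exact: infinite_nat.
  apply/seteqP; split=> // n _ /=; rewrite in_itv /= ltrDl divr_gt0 ?subr_gt0//=.
  by rewrite -ltrBrDl ltr_pdivrMr// ltr_pMr ?subr_gt0// ltr1n.
have /finite_seqP[P0 P0E] := finxi.
pose P := undup P0.
have PE : [set` P] = nonconvex_pts f `&` [set z : pt | z 0 i = xi].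
  by rewrite P0E; apply/seteqP; split=> z /=; rewrite mem_undup.
have cc := @coord_continuous R 1 2 0 i.
have oA : open (U `&` [set z : pt | z 0 i < t]).
  by apply: openI => //; exact: open_lt_fun cc (@cst_continuous_pt t).
have oB : open (U `&` [set z : pt | s < z 0 i]).
  by apply: openI => //; exact: open_lt_fun (@cst_continuous_pt s) cc.
have [||||||||f' [A [B [[f'L f'G ff' f'out] SA cA cB rest]]]] :=
  @cut_points L i xi _ _ P f (nonconvex_pts f `&` [set z | z 0 i < xi])
   (nonconvex_pts f `&` [set z | xi < z 0 i]) oA oB (undup_uniq _) fL fG.
- move=> z Sz; have [zi|zi|zi] := ltgtP (z 0 i) xi; first by left; left.
    by left; right.
  by right; rewrite PE.
- rewrite PE -setIUr (_ : _ `|` _ = [set z : pt | z 0 i <= xi]).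
    apply: closedI; first exact: nonconvex_closed.
    exact: closed_le_fun cc (@cst_continuous_pt xi).
  apply/seteqP; split=> z /=; first by case=> [/ltW//|->].
  by rewrite le_eqVlt => /orP[/eqP|]; [right|left].
- rewrite PE -setIUr (_ : _ `|` _ = [set z : pt | xi <= z 0 i]).
    apply: closedI; first exact: nonconvex_closed.
    exact: closed_le_fun (@cst_continuous_pt xi) cc.
  apply/seteqP; split=> z /=; first by case=> [/ltW//|->].
  by rewrite le_eqVlt => /orP[/eqP|]; [right|left].
- by move=> z [_ /= h1] [_ /= h2]; have := lt_trans h1 h2; rewrite ltxx.
- by move=> z [/SU Uz /= zi]; split=> //=; apply: lt_trans xit.
- by move=> z [/SU Uz /= zi]; split=> //=; apply: lt_trans zi.
- by rewrite PE => z [/SU Uz /= ->].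
- move=> p pP; have : [set` P] p by [].
  rewrite PE => -[Sp /= pxi]; split=> //.
  have [g1 [g2 [g12 g1L g2L /nbhs_ballP[/= r r0 rf]]]] := nb p Sp pxi.
  exists g1, g2, r; split => // z zr.
  have fE x : `|x - p| < r -> f x = f p + Num.min (dot g1 (x - p)) (dot g2 (x - p)).
    by move=> xr; apply: rf; rewrite -ball_normE /= distrC.
  split; first exact: fE.
    by move=> [Sz zi]; split=> //; apply: nonconvex_fold fE zr Sz.
  by move=> [Sz zi]; split=> //; apply: nonconvex_fold fE zr Sz.
- exists f', A, B; split=> //; split=> // z nU; apply: f'out.
  by move=> [[]].
Qed.
End Cut.

(** * The limit construction *)

Section Iteration.
Context {R : realType}.
Local Notation pt := 'rV[R]_2.

Lemma normal_shrink (T : topologicalType) (A O : set T) : normal_space T ->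
  closed A -> open O -> A `<=` O ->
  exists W, [/\ open W, A `<=` W & closure W `<=` O].
Proof.
move=> nT cA oO AO; have [|V AV VO] := nT A cA O.
  by move=> x Ax; apply: open_nbhs_nbhs; split=> //; apply: AO.
exists V°; split; first exact: open_interior.
  by move=> x Ax; exact: AV.
by apply: subset_trans VO; apply: closureS; exact: interior_subset.
Qed.

Definition separates (i : 'I_2) (s t : R) (U : set pt) :=
  exists A B, [/\ open A, open B, U `<=` A `|` B &
    [/\ forall z, A z -> ~ B z, A `<=` [set z | z 0 i < t]
      & B `<=` [set z | s < z 0 i]]].

Definition stage (L : R) (S : (pt -> R) * set pt) :=
  [/\ Lip L S.1, tame L S.1, open S.2 & nonconvex_pts S.1 `<=` S.2].

(** The closure of the new open set lies in the old one, so that the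
intersection of a chain of refinements is closed, and everything is settled
outside the old open set. *)
Definition refines (S S' : (pt -> R) * set pt) :=
  [/\ closure S'.2 `<=` S.2, forall z, S.1 z <= S'.1 z &
    forall z, ~ S.2 z -> S'.1 z = S.1 z].

Lemma stage_cut L S (i : 'I_2) (s t : R) : s < t -> stage L S ->
  exists S', [/\ stage L S', refines S S' & separates i s t S'.2].
Proof.
case: S => f U st [/= fL fG oU SU].
have [f' [A [B [[f'L f'G ff' f'out] SAB cA cB [AB AO BO]]]]] :=
  cut_strip i fL fG oU SU st.
have nT : normal_space pt by exact: (@pseudometric_normal R).
have cc := @coord_continuous R 1 2 0 i.
have oA : open (U `&` [set z : pt | z 0 i < t] `&` ~` B).
  apply: openI; last exact: closed_openC.
  by apply: openI => //; have X := open_lt_fun cc (@cst_continuous_pt R t); exact X.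
have [|W [oW AW cW]] := normal_shrink nT cA oA.
  by move=> z Az; split; [exact: AO|exact: AB].
have oB : open (U `&` [set z : pt | s < z 0 i] `&` ~` closure W).
  apply: openI; last exact/closed_openC/closed_closure.
  by apply: openI => //; exact: open_lt_fun (@cst_continuous_pt R s) cc.
have [|W' [oW' BW' cW']] := normal_shrink nT cB oB.
  by move=> z Bz; split; [exact: BO|move=> /cW[_]; apply].
exists (f', W `|` W'); split; last first.
- exists W, W'; split=> //; split.
  + by move=> z Wz /(@subset_closure _ W')/cW'[_]; apply; exact: subset_closure.
  + by move=> z /(@subset_closure _ W)/cW[[]].
  + by move=> z /(@subset_closure _ W')/cW'[[]].
- by split=> //= z; rewrite closureU => -[/cW[[]]|/cW'[[]]].
- split=> //=; first exact: openU.
  by move=> z /SAB[/AW|/BW']; [left|right].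
Qed.

(** The positive part of the pyramid [min (1 + y) (1 - y - 2 * |x|)], which
is positive inside a triangle only. *)
Lemma initial_stage : exists S : (pt -> R) * set pt,
  [/\ stage 4 S, S.2 `<=` [set z | `|z| < 3 / 2],
   forall z, 3 / 2 <= `|z| -> S.1 z = 0 & 0 < S.1 0].
Proof.
pose g1 : pt := \row_j (j == 1)%:R.
pose g2 : pt := \row_j (if j == 0 then -2 else -1).
pose g3 : pt := \row_j (if j == 0 then 2 else -1).
pose a1 (z : pt) := 1 + dot g1 (z - 0).
pose a2 (z : pt) := 1 + dot g2 (z - 0).
pose a3 (z : pt) := 1 + dot g3 (z - 0).
have aff1 : affine_with g1 a1 by exact: affine_center.
have aff2 : affine_with g2 a2 by exact: affine_center.
have aff3 : affine_with g3 a3 by exact: affine_center.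
have a1E z : a1 z = 1 + z 0 1 by rewrite /a1 /dot !mxE /=; ring.
have a2E z : a2 z = 1 - 2 * z 0 0 - z 0 1 by rewrite /a2 /dot !mxE /=; ring.
have a3E z : a3 z = 1 + 2 * z 0 0 - z 0 1 by rewrite /a3 /dot !mxE /=; ring.
have gne (g h : pt) j : g 0 j != h 0 j -> g <> h by move=> /eqP ne gh; rewrite gh in ne.
have g12 : g1 <> g2 by apply: (gne _ _ 0); rewrite !mxE /=; apply/eqP; lra.
have g13 : g1 <> g3 by apply: (gne _ _ 0); rewrite !mxE /=; apply/eqP; lra.
have g23 : g2 <> g3 by apply: (gne _ _ 0); rewrite !mxE /=; apply/eqP; lra.
have g1L : l1 g1 < 4 by rewrite /l1 !mxE /= normr0 normr1; lra.
have g2L : l1 g2 < 4 by rewrite /l1 !mxE /= !normrN normr1 gtr0_norm; lra.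
have g3L : l1 g3 < 4 by rewrite /l1 !mxE /= !normrN normr1 gtr0_norm; lra.
have r0 : 0 < 6 :> R by lra.
pose Q := min3 a1 a2 a3; pose f : pt -> R := fun=> 0.
have fL : Lip 4 f by move=> x y; rewrite subrr normr0 mulr_ge0.
have Sf z : ~ nonconvex_pts f z.
  by apply; exists 1 => // x y _ _ t _; rewrite !mulr0 addr0.
have fG : tame 4 f.
  split; first by apply: sub_finite_set (finite_set0 _) => z [/Sf].
  move=> i; apply: sub_finite_set (finite_set0 _) => xi /=; apply.
  by apply: sub_finite_set (finite_set0 _) => z [/Sf].
have QL : Lip 4 Q by exact: min3_Lip aff1 aff2 aff3 g1L g2L g3L.
have Qlow (z : pt) : 6 / 4 <= `|z - 0| -> `|z - 0| < 6 -> Q z < f z.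
  rewrite subr0 => z4 _; rewrite ltNge; apply/negP.
  rewrite /Q /min3 !le_min a1E a2E a3E /f => /and3P[h1 h2 h3].
  move: z4; rewrite leNgt => /negP; apply.
  by apply: norm_lt_coord; rewrite ltr_norml; lra.
have zP (x y : R) : finite_set [set z : pt | z 0 0 = x /\ z 0 1 = y].
  apply: sub_finite_set (finite_set1 (\row_j (if j == 0 then x else y))) => z [zx zy].
  by apply: rV2P; rewrite !mxE.
exists (raise f Q 0 6, [set z : pt | `|z - 0| < 6 / 4]); split.
- split => /=.
  + exact: raise_Lip r0 fL QL Qlow.
  + apply: (@tame_raise _ 4 f 0 6 g1 g2 g3) => //.
      apply: (@sub_finite_set _ _ ([set z : pt | z 0 0 = 0 /\ z 0 1 = 1] `|`
        [set z : pt | z 0 0 = 1 /\ z 0 1 = -1] `|`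
        [set z : pt | z 0 0 = -1 /\ z 0 1 = -1])); last by rewrite !finite_setU.
      move=> z [_ fQ [/Sf//|]]; move: fQ.
      rewrite /f /Q /min3 /tie a1E a2E a3E => /esym fQ.
      case=> -[e l].
      + left; right; move: fQ; rewrite -e [X in Num.min _ X]min_l// minxx => fQ.
        by split; lra.
      + right; move: fQ; rewrite -e [X in Num.min _ X]min_r// minxx => fQ.
        by split; lra.
      + left; left; move: fQ; rewrite -e minxx min_r// => fQ.
        by split; lra.
    apply: sub_finite_set (zP 0 0) => z /=; rewrite a1E a2E a3E => -[? ?].
    by split; lra.
  + exact: open_lt_fun (@dist_continuous R pt 0) (@cst_continuous_pt R _).
  + by move=> z /(nonconvex_raise r0 fL QL Qlow) [[/Sf]|[]].
- by move=> z /=; rewrite subr0; lra.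
- by move=> z z4 /=; rewrite (raise_out Qlow) // subr0; lra.
- rewrite /= /raise subr0 normr0 r0 /f lt_max /Q /min3 !lt_min a1E a2E a3E !mxE.
  by apply/orP; right; apply/and3P; split; lra.
Qed.

Lemma separates_sub i s t (U U' : set pt) : U' `<=` U ->
  separates i s t U -> separates i s t U'.
Proof.
move=> UU' [A [B [oA oB UAB ABst]]]; exists A, B; split => //.
exact: subset_trans UU' UAB.
Qed.

(** Two distinct points differ in some coordinate, and rational numbers
squeezed between the two values of it provide a separation that puts the points
on different sides. *)
Lemma separates_totally_disconnected (M : set pt) :
  (forall i (s t : rat), s < t -> separates i (ratr s) (ratr t) M) ->
  totally_disconnected M.
Proof.
move=> Msep.
have sep (C : set pt) x y i : connected C -> C `<=` M -> C x -> C y ->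
    x 0 i < y 0 i -> False.
  move=> conC CM Cx Cy xy.
  have [s] := rat_in_itvoo xy; rewrite in_itv /= => /andP[xs sy].
  have [t] := rat_in_itvoo sy; rewrite in_itv /= => /andP[st ty].
  rewrite ltr_rat in st; have [A [B [oA oB MAB [AB At Bs]]]] := Msep i s t st.
  have CAB z : C z -> A z \/ B z by move=> /CM/MAB.
  have Ax : A x by case: (CAB x Cx) => // /Bs /=; rewrite ltNge ltW.
  have By : B y by case: (CAB y Cy) => // /At /=; rewrite ltNge ltW.
  have CA : C `&` A = C.
    apply: conC; first by exists x.
      by exists A.
    exists (~` B); first exact: open_closedC.
    apply/seteqP; split=> z [Cz zA]; split=> //; first exact: AB.
    by case: (CAB z Cz).
  by have [_ /AB] : (C `&` A) y by rewrite CA.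
move=> x Mx; apply/seteqP; split; last first.
  by move=> _ ->; exact: connected_component_refl.
move=> y Cy; set C := connected_component M x in Cy *.
have cC : connected C by exact: component_connected.
have CM : C `<=` M by exact: connected_component_sub.
have Cx : C x by exact: connected_component_refl.
have yx i : y 0 i = x 0 i.
  have [/(sep C _ _ _ cC CM Cy Cx)//|/(sep C _ _ _ cC CM Cx Cy)//|//] :=
    ltgtP (y 0 i) (x 0 i).
exact: rV2P.
Qed.

Lemma bump_not_convex (w : pt) (f : pt -> R) :
  f w = 0 -> f (- w) = 0 -> 0 < f 0 -> ~ convex_function setT f.
Proof.
move=> fw fNw f0 cvx.
have h0 : 0 <= 1 / 2 :> R by lra.
have h1 : 1 / 2 <= 1 :> R by lra.
have : f ((1 / 2) *: w + (1 - 1 / 2) *: (- w)) <=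
    (1 / 2) * f w + (1 - 1 / 2) * f (- w).
  by apply: (cvx (Itv01 h0 h1) w (- w)); rewrite inE.
have -> : (1 / 2) *: w + (1 - 1 / 2) *: (- w) = 0.
  by apply: rV2P; rewrite !mxE; field.
by rewrite fw fNw !mulr0 addr0 leNgt f0.
Qed.

End Iteration.

Unset Implicit Arguments.

Theorem theorem1p1 (R : realType) :
  exists (f : 'rV[R]_2 -> R) (M : set 'rV[R]_2),
    [/\ lipschitz f,
        locally_convex_on (~` M) f,
        ~ convex_function setT f,
        compact M /\ totally_disconnected M
      & compactly_supported f].
Proof.
have [S0 [S0st S0U S0out S00]] := @initial_stage R.
pose pt := 'rV[R]_2.
(* Every [i] and every pair of rationals [s < t] occurs as [data n]. *)
pose data (n : nat) : 'I_2 * R * R :=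
  if (unpickle n : option ('I_2 * rat * rat)) is Some (i, s, t) then
    if s < t then (i, ratr s, ratr t) else (0, 0, 1)
  else (0, 0, 1).
have dataP n : (data n).1.2 < (data n).2.
  rewrite /data; case: (unpickle n) => [[[i s] t]|] /=; last exact: ltr01.
  by case: ifP => //= st; rewrite ltr_rat.
have /choice[F FP] (x : nat * ((pt -> R) * set pt)) : exists S', stage 4 x.2 ->
    [/\ stage 4 S', refines x.2 S'
      & separates (data x.1).1.1 (data x.1).1.2 (data x.1).2 S'.2].
  have [st|nst] := pselect (stage 4 x.2); last by exists x.2.
  by have [S' ?] := stage_cut (data x.1).1.1 (dataP x.1) st; exists S'.
pose S := fix S n := if n is m.+1 then F (m, S m) else S0.
have Sst n : stage 4 (S n).
  by elim: n => [|n IH] //=; case: (FP (n, S n) IH).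
have Sref n : refines (S n) (S n.+1) by case: (FP (n, S n) (Sst n)).
have Ssep n : separates (data n).1.1 (data n).1.2 (data n).2 (S n.+1).2.
  by case: (FP (n, S n) (Sst n)).
pose fn n := (S n).1; pose U n := (S n).2.
have US n : closure (U n.+1) `<=` U n by case: (Sref n).
have Umono m n : (m <= n)%N -> U n `<=` U m.
  elim: n => [|n IH]; first by rewrite leqn0 => /eqP ->.
  rewrite leq_eqVlt => /orP[/eqP -> //|mn] z zU.
  by apply: (IH mn); apply: US; exact: subset_closure.
have fmono m n z : (m <= n)%N -> fn m z <= fn n z.
  elim: n => [|n IH]; first by rewrite leqn0 => /eqP ->.
  rewrite leq_eqVlt => /orP[/eqP -> //|mn].
  by apply: le_trans (IH mn) _; case: (Sref n) => _ + _; apply.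
have fstat m n z : ~ U m z -> (m <= n)%N -> fn n z = fn m z.
  move=> nU; elim: n => [|n IH]; first by rewrite leqn0 => /eqP ->.
  rewrite leq_eqVlt => /orP[/eqP -> //|mn]; rewrite -(IH mn).
  by case: (Sref n) => _ _; apply => Un; apply: nU; apply: Umono Un.
have U0n n : U n `<=` [set z | `|z| < 3 / 2].
  by move=> z /(Umono _ _ (leq0n n))/S0U.
have f0out n z : 3 / 2 <= `|z| -> fn n z = 0.
  move=> z32; rewrite (@fstat 0)//; first exact: S0out.
  by move=> /S0U /=; rewrite ltNge z32.
(* Off [M] the supremum is reached after finitely many steps. *)
pose M := \bigcap_n U n.
pose f z := sup (range (fn ^~ z)).
pose w0 : pt := const_mx 2.
have w032 : 3 / 2 <= `|w0|.
  by have := coord_le_norm w0 0; rewrite mxE gtr0_norm//; lra.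
have fub z : has_ubound (range (fn ^~ z)).
  exists (4 * `|z - w0|) => _ [n _ <-].
  have [fL _ _ _] := Sst n; have := fL z w0.
  by rewrite -/(fn n) (f0out n w0)// subr0; apply: le_trans; exact: ler_norm.
have fne z : range (fn ^~ z) !=set0 by exists (fn 0 z), 0.
have fge n z : fn n z <= f z by apply: (ub_le_sup (fub z)); exists n.
have fE n z : ~ U n z -> f z = fn n z.
  move=> nU; apply/eqP; rewrite eq_le fge andbT.
  apply: ge_sup => // _ [m _ <-]; have [nm|/ltnW mn] := leqP n m.
    by rewrite (fstat n m).
  exact: fmono.
have fL : Lip 4 f.
  have half x y : f x <= f y + 4 * `|x - y|.
    apply: ge_sup => // _ [n _ <-]; rewrite (le_trans _ (lerD (fge n y) (lexx _)))//.
    have [/(_ x y) + _ _ _] := Sst n.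
    by rewrite -/(fn n) ler_norml; lra.
  by move=> x y; rewrite ler_norml; have := half x y; have := half y x;
    rewrite (distrC y x); lra.
have fout z : 3 / 2 <= `|z| -> f z = 0.
  by move=> z32; rewrite (fE 0) ?f0out// => /U0n /=; rewrite ltNge z32.
have cf := Lip_continuous fL.
have bounded_small (A : set pt) : A `<=` [set z | `|z| <= 3 / 2] -> bounded_set A.
  move=> A32; exists (3 / 2); split; first exact: num_real.
  by move=> x x32 z /A32 /= z32; apply: le_trans z32 (ltW x32).
exists f, M; split.
- apply: (@klipschitzW _ _ _ 4); first exact: (@globally_properfilter _ _ (w0, w0)).
  by move=> [x y] _ /=; apply: fL.
- move=> x y xyM t t01; apply: convex_at_segment => // z xyz.
  (* One more step makes [f] equal to [fn n.+1] on a whole neighbourhood. *)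
  have [n nU] : exists n, ~ U n z.
    apply: contrapT => h; apply: (xyM z xyz) => n _.
    by apply: contrapT => nU; apply: h; exists n.
  have oC : open (~` closure (U n.+1)) by exact/closed_openC/closed_closure.
  have zC : ~ closure (U n.+1) z by move=> /US.
  apply: (@convex_at_near _ _ _ (fn n.+1)).
    have : nbhs z (~` closure (U n.+1)) by apply: open_nbhs_nbhs.
    apply: filterS => x' x'U; apply: fE => Ux; apply: x'U; exact: subset_closure.
  apply: contrapT => Sz; apply: zC; apply: subset_closure.
  by have [_ _ _] := Sst n.+1; apply.
- apply: (@bump_not_convex R w0); [by rewrite fout|by rewrite fout ?normrN|].
  exact: lt_le_trans S00 (fge 0 0).
- split.
    apply: bounded_closed_compact.
      by apply: bounded_small => z /(_ 0 I)/(U0n 0) /ltW.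
    rewrite (_ : M = \bigcap_n closure (U n)).
      by apply: closed_bigI => n _; exact: closed_closure.
    apply/seteqP; split => z zM n _; first exact/subset_closure/zM.
    by apply: US; apply: zM.
  apply: separates_totally_disconnected => i s t st.
  have := Ssep (pickle (i, s, t)); rewrite /data pickleK st /=.
  by apply: separates_sub => z zM; apply: (zM (pickle (i, s, t)).+1).
- apply: bounded_closed_compact; last exact: closed_closure.
  apply: bounded_small.
  have cl : closed [set z : pt | `|z| <= 3 / 2].
    have := closed_le_fun (@dist_continuous R pt 0) (@cst_continuous_pt R (3 / 2)).
    by congr closed; apply/seteqP; split => z /=; rewrite subr0.
  rewrite ((closure_id _).1 cl); apply: closureS => z /= fz.
  by rewrite leNgt; apply/negP => /ltW /fout fz0; rewrite fz0 eqxx in fz.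
Qed.
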